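(* Let $(X,(P_t)_{t\in\mathbb{R}})$ be a resolution space with $X$ reflexive. Let $M\colon D(M)\subseteq X\to X$ be linear and closable, with closure $\overline{M}$. Then the following statements are equivalent: (i) $\overline{M}$ is causal (with respect to $(P_t)_t$); (ii) $M$ is n-strongly causal (with respect to $(P_t)_t$).
   Context: For a Banach space $X$, $L(X)$ denotes the bounded linear operators on $X$, $X'$ the dual space, and $|\cdot|$ the norm of $X$. A family $(P_t)_{t\in\mathbb{R}}$ in $L(X)$ is a resolution of the identity if every $P_t$ is a projection, $\operatorname{range}(P_t)\subseteq\operatorname{range}(P_s)$ if and only if $t\le s$, and $P_t$ converges in the weak operator topology to $0$ as $t\to-\infty$ and to the identity as $t\to\infty$. The pair $(X,(P_t)_t)$ is then called a resolution space. A map $N\colon D(N)\subseteq X\to X$ is causal with respect to $(P_t)_t$ if for all $a\in\mathbb{R}$ and all $f,g\in D(N)$ with $P_a(f-g)=0$ one has $P_a(N(f)-N(g))=0$. For $P\in L(X)$, a map $N\colon D(N)\subseteq X\to X$ is n-strongly (norm-strongly) $P$-compatible if for all $R>0$ and $x'\in X'$ the map $B_N(0,R)\to X$, $f\mapsto Nf$, is uniformly continuous when $B_N(0,R):=\{f\in D(N): |f|+|Nf|<R\}$ carries the pseudometric $(f,g)\mapsto|P(f-g)|$ and $X$ carries the pseudometric $(u,v)\mapsto|\langle P(u-v),x'\rangle|$. The map $N$ is n-strongly causal (with respect to $(P_t)_t$) if it is n-strongly $P_t$-compatible for all $t\in\mathbb{R}$. *)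

(* Defs.v *)
From HB Require Import structures.
From mathcomp Require Import all_boot all_order all_algebra.
From mathcomp Require Import all_classical all_reals all_analysis.
From mathcomp Require Import complex.

Set Implicit Arguments.
Unset Strict Implicit.
Unset Printing Implicit Defensive.

Import Order.TTheory GRing.Theory Num.Theory.
Import numFieldNormedType.Exports.

Local Open Scope classical_set_scope.
Local Open Scope ring_scope.

Inductive scalar_kind := real_scalars | complex_scalars.

(* A normed module over [K : numFieldType] has a [K]-valued norm; over
   [complex R] a positive element is a positive real number, so that [0 < r]
   in [K] always ranges over the positive reals. *)
Definition scalar_field (R : realType) (k : scalar_kind) : numFieldType :=
  match k with
  | real_scalars => R
  | complex_scalars => complex R
  end.

Section scalar_field.
Variables (R : realType) (k : scalar_kind).
Local Notation K := (scalar_field R k).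

Definition real_to_scalar : R -> K :=
  match k return R -> scalar_field R k with
  | real_scalars => fun r => r
  | complex_scalars => fun r => Complex r 0
  end.

Definition scalar_to_real : K -> R :=
  match k return scalar_field R k -> R with
  | real_scalars => fun z => z
  | complex_scalars => fun z => complex.Re z
  end.

End scalar_field.

Section scalar_field_theory.
Variables (R : realType) (k : scalar_kind).
Local Notation K := (scalar_field R k).
Local Notation toK := (@real_to_scalar R k).
Local Notation toR := (@scalar_to_real R k).

Lemma real_to_scalarK : cancel toK toR.
Proof. by rewrite /real_to_scalar /scalar_to_real; case: k. Qed.

Lemma scalar_to_realK (z : K) : 0 <= z -> toK (toR z) = z.
Proof.
rewrite /real_to_scalar /scalar_to_real; case: k z => //= -[a b].
by rewrite lecE /= => /andP[/eqP -> _].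
Qed.

Lemma real_to_scalarD a b : toK (a + b) = toK a + toK b.
Proof.
rewrite /real_to_scalar; case: k => //=.
by apply/eqP; rewrite eq_complex /= addr0 !eqxx.
Qed.

Lemma real_to_scalarM a b : toK (a * b) = toK a * toK b.
Proof.
rewrite /real_to_scalar; case: k => //=.
by apply/eqP; rewrite eq_complex /= mulr0 mul0r mulr0 subr0 addr0 !eqxx.
Qed.

Lemma real_to_scalar0 : toK 0 = 0.
Proof. by rewrite /real_to_scalar; case: k. Qed.

Lemma ler_real_to_scalar a b : (toK a <= toK b) = (a <= b).
Proof. by rewrite /real_to_scalar; case: k => //=; rewrite lecE /= eqxx. Qed.

Lemma ler_scalar_to_real (y z : K) : 0 <= y -> y <= z -> toR y <= toR z.
Proof.
move=> y0 yz; rewrite -ler_real_to_scalar !scalar_to_realK//.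
exact: le_trans yz.
Qed.

End scalar_field_theory.

Section dual.
Variables (R : realType) (k : scalar_kind).
Local Notation K := (scalar_field R k).
Variable X : normedModType K.

Definition in_dual : {pred (X -> K^o)} :=
  [pred f : X -> K^o | `[< linear f /\ continuous f >]].

Lemma in_dualP (f : X -> K^o) : reflect (linear f /\ continuous f) (f \in in_dual).
Proof. exact: asboolP. Qed.

Lemma in_dual_submod_closed : submod_closed in_dual.
Proof.
split.
  apply/in_dualP; split; last exact: cst_continuous.
  by move=> a x y; rewrite -[LHS]/(0 : K^o) scaler0 addr0.
move=> a f g /in_dualP[lf cf] /in_dualP[lg cg]; apply/in_dualP; split.
  move=> b x y; rewrite !fctE lf lg !scalerDr !scalerA (mulrC b).
  by rewrite addrACA.
move=> x; apply: cvgD; last exact: cg.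
by apply: cvgZl_tmp; exact: cf.
Qed.

HB.instance Definition _ :=
  GRing.isSubmodClosed.Build K (X -> K^o) in_dual in_dual_submod_closed.

Record dual := Dual { dual_fun :> X -> K^o; dualP : dual_fun \in in_dual }.

HB.instance Definition _ := [isSub for dual_fun].
HB.instance Definition _ := [Choice of dual by <:].
HB.instance Definition _ := [SubChoice_isSubLmodule of dual by <:].

End dual.

Section dual_norm.
Variables (R : realType) (k : scalar_kind).
Local Notation K := (scalar_field R k).
Variable X : normedModType K.
Local Notation toK := (@real_to_scalar R k).
Local Notation toR := (@scalar_to_real R k).
Implicit Types f g : dual X.

Definition dual_norm f : K :=
  toK (sup [set toR `|f x| | x in [set x : X | `|x| <= 1]]).

Lemma dual_linear f : linear f.
Proof. by have /in_dualP[] := dualP f. Qed.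

Lemma dual_continuous f : continuous f.
Proof. by have /in_dualP[] := dualP f. Qed.

Let dual0 f : f 0 = 0.
Proof.
by have := dual_linear f (-1) 0 0; rewrite [in LHS]scaler0 addr0 scaleN1r addNr.
Qed.

Let dualZ f a x : f (a *: x) = a * f x.
Proof. by have := dual_linear f a x 0; rewrite !addr0 dual0 addr0. Qed.

Lemma dual_bounded f : exists2 C : K, 0 <= C & forall x, `|f x| <= C * `|x|.
Proof.
pose F : {linear X -> K^o} := HB.pack (dual_fun f)
  (GRing.isLinear.Build _ _ _ _ _ (dual_linear f)).
have /linear_boundedP/pinfty_ex_gt0[r r0 fr] : bounded_near F (nbhs 0).
  by apply/linear_bounded_continuous; exact: dual_continuous.
by exists r; [exact: ltW|exact: fr].
Qed.

Let A f := [set toR `|f x| | x in [set x : X | `|x| <= 1]].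

Let has_supA f : has_sup (A f).
Proof.
split; first by exists (toR `|f 0|), 0 => //=; rewrite normr0.
have [C C0 fC] := dual_bounded f; exists (toR C) => _ [x /= x1 <-].
by rewrite ler_scalar_to_real// (le_trans (fC x))// ler_piMr.
Qed.

Lemma le_dual_norm f x : `|x| <= 1 -> `|f x| <= dual_norm f.
Proof.
move=> x1; rewrite -[leLHS]scalar_to_realK// ler_real_to_scalar.
by apply: sup_upper_bound; [exact: has_supA|exists x].
Qed.

Lemma dual_norm_ge0 f : 0 <= dual_norm f.
Proof. by apply: le_trans (le_dual_norm f (x := 0) _); rewrite ?normr0. Qed.

Lemma dual_norm_le f (C : K) : 0 <= C ->
  (forall x, `|x| <= 1 -> `|f x| <= C) -> dual_norm f <= C.
Proof.
move=> C0 fC; rewrite -[leRHS]scalar_to_realK// ler_real_to_scalar.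
apply: ge_sup; first by have [] := has_supA f.
by move=> _ [x /= x1 <-]; rewrite ler_scalar_to_real// fC.
Qed.

Lemma dual_normP f x : `|f x| <= dual_norm f * `|x|.
Proof.
have [->|x0] := eqVneq x 0; first by rewrite dual0 !normr0 mulr0.
rewrite -ler_pdivrMr ?normr_gt0//.
have -> : `|f x| / `|x| = `|f (`|x|^-1 *: x)|.
  by rewrite dualZ normrM normfV normr_id mulrC.
by apply: le_dual_norm; rewrite normrZ normfV normr_id mulVf ?normr_eq0.
Qed.

Let dual_norm_triangle f g : dual_norm (f + g) <= dual_norm f + dual_norm g.
Proof.
apply: dual_norm_le; first by rewrite addr_ge0 ?dual_norm_ge0.
move=> x x1; apply: le_trans (ler_normD _ _) _.
by apply: lerD; exact: le_dual_norm.
Qed.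

Let dual_normZ_le (a : K) f : dual_norm (a *: f) <= `|a| * dual_norm f.
Proof.
apply: dual_norm_le; first by rewrite mulr_ge0 ?dual_norm_ge0.
move=> x x1; have -> : `|(a *: f) x| = `|a| * `|f x| by exact: normrM.
by rewrite ler_wpM2l// le_dual_norm.
Qed.

Let dual_norm_eq0 f : dual_norm f = 0 -> f = 0.
Proof.
move=> f0; apply/val_inj/funext => x /=; apply/normr0_eq0/le_anti.
by rewrite normr_ge0 andbT (le_trans (dual_normP f x))// f0 mul0r.
Qed.

Let dual_normZ (a : K) f : dual_norm (a *: f) = `|a| * dual_norm f.
Proof.
apply/le_anti; rewrite dual_normZ_le /=.
have [->|a0] := eqVneq a 0; first by rewrite normr0 mul0r dual_norm_ge0.
rewrite -ler_pdivlMl ?normr_gt0// -normfV.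
by rewrite (le_trans _ (dual_normZ_le _ _))// scalerA mulVf// scale1r.
Qed.

HB.instance Definition _ := Lmodule_isNormed.Build K (dual X)
  dual_norm_triangle dual_normZ dual_norm_eq0.

End dual_norm.

(* Surjectivity of the canonical map of [X] into its bidual, where [dual X] is
   normed by [dual_norm]. *)
Definition reflexive_space (R : realType) (k : scalar_kind)
    (X : normedModType (scalar_field R k)) : Prop :=
  forall phi : dual (dual X), exists x : X, forall f : dual X, phi f = f x.

(* The operator with domain [dom N] and value [N x] at [x \in dom N]; the values
   outside [dom N] are irrelevant. *)
Record partial_map (X : Type) := PartialMap { dom : set X; pfun :> X -> X }.

Definition graph (X : Type) (N : partial_map X) : set (X * X) :=
  [set z | dom N z.1 /\ z.2 = N z.1].

Section operators.
Variables (R : realType) (k : scalar_kind).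
Local Notation K := (scalar_field R k).
Variable X : normedModType K.
Implicit Types (P : {linear X -> X}) (N M : partial_map X).

Definition linear_operator M : Prop :=
  dom M 0 /\
  forall (a : K) (f g : X), dom M f -> dom M g ->
    dom M (a *: f + g) /\ M (a *: f + g) = a *: M f + M g.

Definition closable M : Prop :=
  forall f u v, closure (graph M) (f, u) -> closure (graph M) (f, v) -> u = v.

Definition closure_operator M : partial_map X :=
  PartialMap [set f | exists u, closure (graph M) (f, u)]
             (fun f => xget 0 [set u | closure (graph M) (f, u)]).

Lemma graph_closure_operator M :
  closable M -> graph (closure_operator M) = closure (graph M).
Proof.
move=> Mc; apply/seteqP; split=> -[f u] /=.
  move=> [[v fv] /= ->].
  exact: (@xgetPex _ 0 [set w | closure (graph M) (f, w)]) (ex_intro _ v fv).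
move=> fu; split; first by exists u.
apply: (Mc _ _ _ fu) => /=.
exact: (@xgetPex _ 0 [set w | closure (graph M) (f, w)]) (ex_intro _ u fu).
Qed.

Definition resolution_of_identity (P : R -> {linear X -> X}) : Prop :=
  [/\ forall t, continuous (P t),
      forall t x, P t (P t x) = P t x,
      forall s t, range (P t) `<=` range (P s) <-> t <= s,
      forall (x : X) (x' : dual X), x' (P t x) @[t --> -oo] --> (0 : K^o) &
      forall (x : X) (x' : dual X), x' (P t x) @[t --> +oo] --> (x' x : K^o)].

Definition causal (P : R -> {linear X -> X}) N : Prop :=
  forall (a : R) (f g : X), dom N f -> dom N g ->
    P a (f - g) = 0 -> P a (N f - N g) = 0.

Definition graph_ball N (r : K) : set X :=
  [set f | dom N f /\ `|f| + `|N f| < r].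

Definition n_strongly_compatible P N : Prop :=
  forall (r : K) (x' : dual X), 0 < r ->
  forall eps : K, 0 < eps -> exists2 delta : K, 0 < delta &
  forall f g, graph_ball N r f -> graph_ball N r g ->
    `|P (f - g)| < delta -> `|x' (P (N f - N g))| < eps.

Definition n_strongly_causal (P : R -> {linear X -> X}) N : Prop :=
  forall t, n_strongly_compatible (P t) N.

End operators.

(* Main.v *)
(* Put [P = P t], let [G] be the graph of [M] and let [W] be the subspace of
   [X' x X'] of all pairs [(a, b)] such that [a f + b u = y' (P f)] on [G] for
   some [y' : X'].  If [(0, x' o P)] is in the closure of [W], then up to a
   small multiple of the graph norm [x' (P u)] is bounded by a multiple of
   [|P f|] on [G], which is n-strong compatibility.  Otherwise Hahn-Banach gives
   a functional on [X' x X'] that vanishes on [W] but not at [(0, x' o P)]; by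
   reflexivity it is evaluation at some [(x1, x2)], where [P x1 = 0], [(x1, x2)]
   is in the closure of [G] and [x' (P x2) <> 0], so that the closure of [M] is
   not causal.  This replaces weak compactness of balls by duality.  The other
   implication is an approximation argument. *)
Require Import Defs.
From HB Require Import structures.
From mathcomp Require Import all_boot all_order all_algebra.
From mathcomp Require Import all_classical all_reals all_analysis.
From mathcomp Require Import complex ring lra.
Set Implicit Arguments.
Unset Strict Implicit.
Unset Printing Implicit Defensive.
Import Order.TTheory GRing.Theory Num.Theory.
Import numFieldNormedType.Exports.
Local Open Scope classical_set_scope.
Local Open Scope ring_scope.

(** * Real Hahn-Banach theorem for sublinear functionals *)

Section sublinear.
Variables (R : realType) (E : lmodType R).
Implicit Types (p q : E -> R) (x y : E).

(** Homogeneity is asked as an inequality, which infima deliver directly; [sublinearZ] recovers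
    equality by scaling back with [t^-1]. *)
Definition sublinear p :=
  (forall x y, p (x + y) <= p x + p y) /\
  (forall t x, 0 <= t -> p (t *: x) <= t * p x).

Lemma sublinear0 p : sublinear p -> p 0 = 0.
Proof.
move=> [pD pZ]; apply/le_anti/andP; split.
  by have := pZ 0 0 (lexx _); rewrite scale0r mul0r.
by have := pD 0 0; rewrite addr0 lerDl.
Qed.

Lemma sublinearZ p t x : sublinear p -> 0 <= t -> p (t *: x) = t * p x.
Proof.
move=> sp; rewrite le_eqVlt => /predU1P[<-|t0].
  by rewrite scale0r mul0r sublinear0.
have [_ pZ] := sp; apply/le_anti; rewrite pZ ?(ltW t0)//=.
rewrite mulrC -ler_pdivlMr// mulrC.
have := pZ t^-1 (t *: x); rewrite scalerA mulVf ?gt_eqF// scale1r.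
by apply; rewrite invr_ge0 ltW.
Qed.

Lemma sublinear_opp_le p x : sublinear p -> - p (- x) <= p x.
Proof.
move=> sp; have [pD _] := sp.
by have := pD x (- x); rewrite subrr sublinear0// -lerBlDr sub0r.
Qed.

Lemma sublinear_le_opp p q x : sublinear q -> (forall y, q y <= p y) ->
  - p (- x) <= q x.
Proof.
by move=> sq qp; apply: le_trans (sublinear_opp_le x sq); rewrite lerN2.
Qed.

(** Applied to a minimal [q], for which [q <= q'], the second bound becomes
    [q x + q y <= q (x + y)], the missing half of additivity. *)
Lemma sublinear_shift q y : sublinear q ->
  exists2 q', sublinear q' &
    forall x, q' x <= q x /\ q' x <= q (x + y) - q y.
Proof.
move=> sq; have [qD qZ] := sq.
(* [q'] is the infimum of [A x]: [t = 0] and [t = 1] give the two bounds, and subadditivity keeps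
   [A x] above [- q (- x)]. *)
pose A x := [set q (x + t *: y) - t * q y | t in [set t : R | 0 <= t]].
have lbA x : lbound (A x) (- q (- x)).
  move=> _ [t /= t0 <-]; have := qD (x + t *: y) (- x).
  by rewrite addrAC subrr add0r sublinearZ//; lra.
have A0 x : A x !=set0 by exists (q (x + 0 *: y) - 0 * q y), 0 => /=.
have infA x t : 0 <= t -> inf (A x) <= q (x + t *: y) - t * q y.
  by move=> t0; apply: ge_inf; [exists (- q (- x)); exact: lbA|exists t].
exists (fun x => inf (A x)); last first.
  move=> x; split.
    by have := infA x 0 (lexx _); rewrite scale0r addr0 mul0r subr0; apply.
  by have := infA x 1 ler01; rewrite scale1r mul1r.
split=> [x1 x2|s x].
  rewrite -lerBlDr; apply: lb_le_inf => // _ [t /= t0 <-].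
  rewrite lerBlDr -lerBlDl; apply: lb_le_inf => // _ [s /= s0 <-].
  have := infA (x1 + x2) (t + s) (addr_ge0 t0 s0).
  have := qD (x1 + t *: y) (x2 + s *: y).
  rewrite scalerDl addrACA mulrDl; lra.
rewrite le_eqVlt => /predU1P[<-|s0].
  have := infA (0 *: x) 0 (lexx _).
  by rewrite !scale0r addr0 !mul0r subr0 sublinear0.
rewrite mulrC -ler_pdivrMr//; apply: lb_le_inf => // _ [t /= t0 <-].
rewrite ler_pdivrMr//.
have := infA (s *: x) (s * t) (mulr_ge0 (ltW s0) t0).
have := qZ s (x + t *: y) (ltW s0).
rewrite scalerDr scalerA mulrBl; lra.
Qed.

(** Zorn's lemma: a chain is bounded by its pointwise infimum, which is finite because every
    sublinear functional below [p] is at least [- p (- x)] at [x]. *)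
Lemma minimal_sublinear p : sublinear p ->
  exists q, [/\ sublinear q, forall x, q x <= p x &
    forall q', sublinear q' -> (forall x, q' x <= q x) ->
      forall x, q x <= q' x].
Proof.
move=> sp; pose T := {q | sublinear q /\ forall x, q x <= p x}.
(* The order is reversed, so that a maximal element is a minimal functional. *)
pose le_T (q1 q2 : T) := `[< forall x, sval q2 x <= sval q1 x >].
pose p0 : T := exist _ p (conj sp (fun x => lexx (p x))).
have [||A totA|[q [sq qp]] /= qmin] := @ZL_preorder T p0 le_T.
- by move=> q; apply/asboolP.
- move=> q1 q2 q3 /asboolP q12 /asboolP q23; apply/asboolP => x.
  exact: le_trans (q23 x) (q12 x).
- have [[q0 Aq0]|A0] := pselect (A !=set0); last first.
    by exists p0 => q Aq; case: A0; exists q.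
  pose B x := [set sval q x | q in A].
  have lbB x : lbound (B x) (- p (- x)).
    by move=> _ [[q [sq qp]] _ <-]; exact: sublinear_le_opp.
  have B0 x : B x !=set0 by exists (sval q0 x), q0.
  have infB x r : A r -> inf (B x) <= sval r x.
    by move=> Ar; apply: ge_inf; [exists (- p (- x)); exact: lbB|exists r].
  have sinf : sublinear (fun x => inf (B x)).
    split=> [x1 x2|s x].
      rewrite -lerBlDr; apply: lb_le_inf => // _ [r1 Ar1 <-].
      rewrite lerBlDr -lerBlDl; apply: lb_le_inf => // _ [r2 Ar2 <-].
      rewrite lerBlDl.
      (* The lower of the two members serves for both arguments, through its own subadditivity. *)
      have [/asboolP r12|/asboolP r21] := totA _ _ Ar1 Ar2.
        have [rD _] := (svalP r2).1.
        apply: le_trans (infB _ _ Ar2) (le_trans (rD _ _) _).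
        by rewrite lerD2r.
      have [rD _] := (svalP r1).1.
      apply: le_trans (infB _ _ Ar1) (le_trans (rD _ _) _).
      by rewrite lerD2l.
    rewrite le_eqVlt => /predU1P[<-|s0].
      apply: le_trans (infB _ _ Aq0) _.
      by rewrite scale0r mul0r sublinear0//; exact: (svalP q0).1.
    rewrite mulrC -ler_pdivrMr//; apply: lb_le_inf => // _ [r Ar <-].
    rewrite ler_pdivrMr// mulrC; apply: le_trans (infB _ _ Ar) _.
    by have [_ rZ] := (svalP r).1; apply: rZ; exact: ltW.
  have infp x : inf (B x) <= p x.
    exact: le_trans (infB _ _ Aq0) ((svalP q0).2 x).
  exists (exist _ (fun x => inf (B x)) (conj sinf infp)) => r Ar.
  by apply/asboolP => x /=; exact: infB.
exists q; split=> // q' sq' q'q.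
have q'p x : q' x <= p x by exact: le_trans (qp x).
have := qmin (exist _ q' (conj sq' q'p)).
by rewrite /le_T /= => H; apply/asboolP/H/asboolP.
Qed.

(* A minimal sublinear functional is linear: it cannot be strictly decreased by
   [sublinear_shift]. *)
Lemma hahn_banach_sublinear p v : sublinear p ->
  exists2 u : E -> R^o, linear u & (forall x, u x <= p x) /\ u v = p v.
Proof.
(* Shifting by [v] before minimizing forces [q (- v) <= - p v], hence [q v = p v] once [q] is
   odd. *)
move=> sp; have [p' sp' p'p] := sublinear_shift v sp.
have [q [sq qp' qmin]] := minimal_sublinear sp'.
have qp x : q x <= p x by exact: le_trans (qp' x) (p'p x).1.
have qD x y : q (x + y) = q x + q y.
  apply/le_anti/andP; split; first exact: sq.1.
  have [q' sq' q'q] := sublinear_shift y sq.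
  rewrite -lerBrDr; apply: le_trans (q'q x).2; apply: qmin => // z.
  exact: (q'q z).1.
have qN x : q (- x) = - q x.
  by apply/eqP; rewrite -addr_eq0 -qD addNr sublinear0.
have qZp t x : 0 <= t -> q (t *: x) = t * q x.
  move=> t0; apply/le_anti/andP; split; first exact: sq.2.
  by have := sq.2 t (- x) t0; rewrite scalerN !qN mulrN lerN2.
exists q.
  move=> t x y; rewrite qD; congr (_ + _).
  have [/qZp->//|t0] := leP 0 t.
  have Nt : 0 <= - t by rewrite oppr_ge0 ltW.
  by rewrite -[t *: x]opprK -scaleNr qN qZp// mulNr opprK.
split=> //; apply/le_anti; rewrite qp/= -[leRHS]opprK -qN lerNr.
apply: le_trans (qp' _) _; apply: le_trans (p'p _).2 _.
by rewrite addNr sublinear0// sub0r.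
Qed.

End sublinear.

(** * Passage between real and complex scalars *)

Section scalar_restriction.
Variables (R : realType) (k : scalar_kind).
Local Notation K := (scalar_field R k).
Local Notation toK := (@real_to_scalar R k).

Lemma real_to_scalar1 : toK 1 = 1.
Proof. by rewrite /real_to_scalar; case: k. Qed.

(** An alias, so that the real module structure does not clash with the one of [V] over [K]. *)
Definition restrict_scalars (V : lmodType K) : Type := V.

Variable V : lmodType K.

HB.instance Definition _ := GRing.Zmodule.on (restrict_scalars V).

Let scale (a : R) (x : restrict_scalars V) : restrict_scalars V :=
  (toK a *: (x : V))%R.

Let scaleA a b x : scale a (scale b x) = scale (a * b) x.
Proof. by rewrite /scale scalerA real_to_scalarM. Qed.

Let scale1 : left_id 1 scale.
Proof. by move=> x; rewrite /scale real_to_scalar1 scale1r. Qed.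

Let scaleDr : right_distributive scale +%R.
Proof. by move=> a x y; rewrite /scale scalerDr. Qed.

Let scaleDl x : {morph scale^~ x : a b / a + b}.
Proof. by move=> a b; rewrite /scale real_to_scalarD scalerDl. Qed.

HB.instance Definition _ := GRing.Zmodule_isLmodule.Build R
  (restrict_scalars V) scaleA scale1 scaleDr scaleDl.

Lemma restrict_scalarsE (a : R) (x : restrict_scalars V) :
  a *: x = toK a *: (x : V).
Proof. by []. Qed.

End scalar_restriction.

(* Over the complex numbers, [f x = u x - i u (i x)]. *)
Lemma linear_of_real_part (R : realType) (k : scalar_kind)
    (V : lmodType (scalar_field R k)) (u : restrict_scalars V -> R^o) :
  linear u ->
  exists2 f : V -> (scalar_field R k)^o, linear f &
    forall x, scalar_to_real (f x) = u x.
Proof.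
case: k V u => V u lu; first by exists u.
have uD x y : u (x + y) = u x + u y by have := lu 1 x y; rewrite !scale1r.
have u0 : u 0 = 0 by apply: (addrI (u 0)); rewrite -uD !addr0.
have uZ (a : R) (x : V) : u (Complex a 0 *: x) = a * u x.
  by have := lu a x 0; rewrite !addr0 u0 addr0.
have uZi (a b : R) (x : V) :
    u (Complex a b *: x) = a * u x + b * u (Complex 0 1 *: x).
  have -> : Complex a b = Complex a 0 + Complex b 0 * Complex 0 1 :> complex R.
    apply/eqP; rewrite eq_complex /=.
    by rewrite !(mul0r, mulr0, mulr1, add0r, addr0, subr0) !eqxx.
  by rewrite scalerDl uD uZ -scalerA uZ.
exists (fun x => Complex (u x) (- u (Complex 0 1 *: (x : V)))) => //.
move=> [a b] x y; apply/eqP; rewrite eq_complex /=.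
rewrite uD (uZi a) scalerDr uD scalerA.
have -> : Complex 0 1 * Complex a b = Complex (- b) a :> complex R.
  apply/eqP; rewrite eq_complex /=.
  by rewrite !(mul0r, mulr0, mul1r, add0r, addr0, subr0, sub0r) !eqxx.
have H1 (p q r : R) : a * p + b * q + r = a * p - b * - q + r by ring.
have H2 (p q r : R) : - (- b * p + a * q + r) = a * - q + b * p - r by ring.
rewrite (uZi (- b)); apply/andP; split; apply/eqP; [exact: H1|exact: H2].
Qed.

(** * Separating a point from the closure of a subspace *)

Section hahn_banach.
Variables (R : realType) (k : scalar_kind).
Local Notation K := (scalar_field R k).
Local Notation toK := (@real_to_scalar R k).
Local Notation toR := (@scalar_to_real R k).

Lemma scalar_to_real0 : toR 0 = 0.
Proof. by rewrite -(real_to_scalar0 R k) real_to_scalarK. Qed.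

Lemma ltr_real_to_scalar (a b : R) : (toK a < toK b) = (a < b).
Proof.
by rewrite !lt_neqAle ler_real_to_scalar (can_eq (@real_to_scalarK R k)).
Qed.

Lemma scalar_to_real_gt0 (a : K) : 0 < a -> 0 < toR a.
Proof.
by move=> a0; rewrite -ltr_real_to_scalar real_to_scalar0 scalar_to_realK// ltW.
Qed.

Lemma scalar_to_realD (a b : K) : 0 <= a -> 0 <= b ->
  toR (a + b) = toR a + toR b.
Proof.
move=> a0 b0.
rewrite -{1}(scalar_to_realK a0) -{1}(scalar_to_realK b0).
by rewrite -real_to_scalarD real_to_scalarK.
Qed.

Lemma scalar_to_realM (a b : K) : 0 <= a -> 0 <= b ->
  toR (a * b) = toR a * toR b.
Proof.
move=> a0 b0.
rewrite -{1}(scalar_to_realK a0) -{1}(scalar_to_realK b0).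
by rewrite -real_to_scalarM real_to_scalarK.
Qed.

Lemma scalar_to_real_ge0 (a : K) : 0 <= a -> 0 <= toR a.
Proof. by move=> a0; rewrite -scalar_to_real0 ler_scalar_to_real. Qed.

Lemma norm_real_to_scalar (a : R) : 0 <= a -> `|toK a| = toK a.
Proof.
by move=> a0; rewrite ger0_norm// -(real_to_scalar0 R k) ler_real_to_scalar.
Qed.

Lemma ex_dual (V : normedModType K) (f : V -> K^o) (C : K) :
  linear f -> 0 <= C -> (forall x, `|f x| <= C * `|x|) ->
  exists g : dual V, g =1 f.
Proof.
move=> lf C0 fC.
pose F : {linear V -> K^o} := HB.pack f
  (GRing.isLinear.Build _ _ _ _ _ lf).
have cF : continuous F.
  apply/linear_bounded_continuous; apply/linear_boundedP.
  near=> r => x; apply: le_trans (fC x) _; rewrite ler_wpM2r//.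
  by near: r; apply: nbhs_pinfty_ge; exact: ger0_real.
by exists (Dual (introT (in_dualP f) (conj lf cF))).
Unshelve. all: by end_near. Qed.

(** The dominating functional [p] is the distance to [W]: it vanishes on [W], is at most the norm,
    and is positive at [v], where the real Hahn-Banach functional attains it. *)
Lemma hahn_banach_subspace (V : normedModType K) (W : set V) (v : V) :
  W 0 -> (forall (a : K) x y, W x -> W y -> W (a *: x + y)) -> ~ closure W v ->
  exists2 f : dual V, forall w, W w -> f w = 0 & f v != 0.
Proof.
move=> W0 WD clWv.
pose A x := [set toR `|x - w| | w in W].
have lbA x : lbound (A x) 0.
  by move=> _ [w _ <-]; exact: scalar_to_real_ge0.
have A0 x : A x !=set0 by exists (toR `|x - 0|), 0.
pose p (x : restrict_scalars V) : R := inf (A x).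
have pW x w : W w -> p x <= toR `|(x : V) - w|.
  by move=> Ww; apply: ge_inf; [exists 0; exact: lbA|exists w].
have WZ a x : W x -> W (a *: x).
  by move=> Wx; rewrite -[_ *: _]addr0; exact: WD.
have sp : sublinear p.
  split=> [x1 x2|s x s0].
    rewrite -lerBlDr; apply: lb_le_inf => // _ [w1 Ww1 <-].
    rewrite lerBlDr -lerBlDl; apply: lb_le_inf => // _ [w2 Ww2 <-].
    rewrite lerBlDl -scalar_to_realD//.
    have Ww : W (w1 + w2) by rewrite -[w1]scale1r; exact: WD.
    apply: le_trans (pW _ _ Ww) _; apply: ler_scalar_to_real => //.
    by rewrite opprD addrACA ler_normD.
  move: s0; rewrite le_eqVlt => /predU1P[<-|s0].
    rewrite mul0r; apply: le_trans (pW _ _ W0) _.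
    by rewrite scale0r subr0 normr0 scalar_to_real0.
  rewrite mulrC -ler_pdivrMr//; apply: lb_le_inf => // _ [w Ww <-].
  rewrite ler_pdivrMr//; apply: le_trans (pW _ _ (WZ (toK s) _ Ww)) _.
  rewrite restrict_scalarsE -scalerBr normrZ norm_real_to_scalar ?(ltW s0)//.
  rewrite scalar_to_realM ?real_to_scalarK 1?mulrC//.
  by rewrite -(real_to_scalar0 R k) ler_real_to_scalar ltW.
have pnorm x : p x <= toR `|x : V|.
  by have := pW x 0 W0; rewrite subr0.
have pv : 0 < p v.
  apply: contrapT => /negP; rewrite -leNgt => pv0; apply: clWv.
  rewrite closureEnbhs => B B' WB /nbhs_ballP[e /= e0 eB'].
  have e0' := scalar_to_real_gt0 e0.
  have [_ [w Ww <-] we] : exists2 y, A v y & y < toR e.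
    by apply: inf_lt => //; exact: le_lt_trans e0'.
  exists w; split; first exact: WB.
  apply: eB'; rewrite -ball_normE /=.
  rewrite -(scalar_to_realK (ltW e0)) -[ltLHS]scalar_to_realK//.
  by rewrite ltr_real_to_scalar.
have [u lu [up uv]] := hahn_banach_sublinear (v : restrict_scalars V) sp.
have [f lf fu] := linear_of_real_part lu.
have f0 : f 0 = 0.
  by have := lf (-1) 0 0; rewrite [in LHS]scaler0 addr0 scaleN1r addNr.
have fZ a x : f (a *: x) = a * f x.
  by have := lf a x 0; rewrite !addr0 f0 addr0.
(* Rotating [x] makes [f x] a nonnegative real. *)
have fp x : `|f x| <= toK (p (`|f x| / f x *: x)).
  (* Here the phase factor is [0 / 0 = 0], so both sides vanish. *)
  have [fx0|fx0] := eqVneq (f x) 0.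
    by rewrite fx0 normr0 mul0r scale0r (sublinear0 sp) real_to_scalar0.
  rewrite -[leLHS](scalar_to_realK)// ler_real_to_scalar.
  apply: le_trans (up _); rewrite -fu fZ divfK//.
have nphase x : `| `|f x| / f x | <= 1.
  rewrite normrM normfV normr_id.
  have [->|fx0] := eqVneq (f x) 0; first by rewrite normr0 mul0r ler01.
  by rewrite divff// normr_eq0.
have fx x : `|f x| <= 1 * `|x|.
  apply: le_trans (fp x) _; rewrite mul1r.
  rewrite -[leRHS]scalar_to_realK// ler_real_to_scalar.
  apply: le_trans (pnorm _) _; apply: ler_scalar_to_real => //.
  by rewrite normrZ ler_piMl.
have [g gf] := ex_dual lf ler01 fx.
exists g => [w Ww|]; rewrite gf.
  apply/normr0_eq0/le_anti; rewrite normr_ge0 andbT.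
  apply: le_trans (fp w) _; rewrite -(real_to_scalar0 R k) ler_real_to_scalar.
  set y : V := _ *: w; have Wy : W y by exact: WZ.
  by apply: le_trans (pW y y Wy) _; rewrite subrr normr0 scalar_to_real0.
apply/eqP => fv0; move: pv.
by rewrite -uv -fu fv0 scalar_to_real0 ltxx.
Qed.

End hahn_banach.

(** * Functionals on normed spaces and on their products *)

Section dual_theory.
Variables (R : realType) (k : scalar_kind).
Local Notation K := (scalar_field R k).

Lemma dualD (V : normedModType K) (f : dual V) x y : f (x + y) = f x + f y.
Proof. by have := dual_linear f 1 x y; rewrite !scale1r. Qed.

Lemma dual0 (V : normedModType K) (f : dual V) : f 0 = 0.
Proof.
by have := dualD f 0 0; rewrite addr0 => /eqP; rewrite -subr_eq subrr => /eqP.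
Qed.

Lemma dual_evalP (V : normedModType K) (f g : dual V) (a : K) x :
  (a *: f + g) x = a * f x + g x.
Proof. by []. Qed.

Lemma dual_separating (V : normedModType K) (v : V) :
  (forall f : dual V, f v = 0) -> v = 0.
Proof.
move=> fv; apply: contrapT => v0.
have [|a x y ->->||f _] := @hahn_banach_subspace R k V [set 0] v.
- by [].
- by rewrite /= scaler0 addr0.
- rewrite -(_ : [set 0] = closure [set 0])//; apply/closure_id.
  exact/accessible_closed_set1/hausdorff_accessible/norm_hausdorff.
- by rewrite fv eqxx.
Qed.

(** This is the adjoint of [T] applied to [f]. *)
Lemma ex_dual_comp (U V : normedModType K) (T : {linear U -> V}) (f : dual V) :
  continuous T -> exists g : dual U, forall x, g x = f (T x).
Proof.
move=> cT; have lg : linear (fun x => f (T x)).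
  by move=> a x y; rewrite linearP dual_linear.
have cg : continuous (fun x => f (T x)).
  by move=> x; apply: continuous_comp; [exact: cT|exact: dual_continuous].
by exists (Dual (introT (in_dualP (fun x => f (T x) : K^o)) (conj lg cg))).
Qed.

(** Restrict [f] to the two factors; these embed isometrically for the maximum norm, so a bound for
    [f] bounds both restrictions. *)
Lemma dual_pair (U V : normedModType K) (f : dual (U * V)%type) :
  exists g : dual U, exists h : dual V, forall z, f z = g z.1 + h z.2.
Proof.
have [C C0 fC] := dual_bounded f.
have [|||g fg] := @ex_dual R k U (fun x => f (x, 0)) C => //.
- move=> a x y; rewrite -dual_linear; congr (f _).
  by congr pair; rewrite /= scaler0 addr0.
- move=> x; apply: le_trans (fC _) _.
  by rewrite prod_normE /= normr0 max_l.
have [|||h fh] := @ex_dual R k V (fun x => f (0, x)) C => //.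
- move=> a x y; rewrite -dual_linear; congr (f _).
  by congr pair; rewrite /= scaler0 addr0.
- move=> x; apply: le_trans (fC _) _.
  by rewrite prod_normE /= normr0 max_r.
exists g, h => -[x y]; rewrite fg fh -dualD; congr (f _).
by congr pair; rewrite /= ?addr0 ?add0r.
Qed.

End dual_theory.

Lemma closure_normP (K : numFieldType) (V : normedModType K) (A : set V) v e :
  closure A v -> 0 < e -> exists2 w, A w & `|v - w| < e.
Proof.
move=> Av e0; have [w [Aw]] := Av _ (nbhsx_ballx v e e0).
by rewrite -ball_normE; exists w.
Qed.

Lemma linear_continuous_bounded (K : numFieldType) (U V : normedModType K)
    (T : {linear U -> V}) :
  continuous T -> exists2 C : K, 0 < C & forall x, `|T x| <= C * `|x|.
Proof.
by move/linear_bounded_continuous/linear_boundedP/pinfty_ex_gt0.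
Qed.

(** The order of [K] may be partial, but positive elements are real and hence comparable. *)
Lemma ex_pos_le (K : numFieldType) (a b : K) : 0 < a -> 0 < b ->
  exists2 c, 0 < c & c <= a /\ c <= b.
Proof.
move=> a0 b0.
have [ab|/ltW ba] := real_leP (gtr0_real a0) (gtr0_real b0); first by exists a.
by exists b.
Qed.

(** * The two implications for a single operator [P] *)

Section compatibility.
Variables (R : realType) (k : scalar_kind).
Local Notation K := (scalar_field R k).
Variables (X : normedModType K) (P : {linear X -> X}) (M : partial_map X).
Hypothesis cP : continuous P.

Lemma graph_linear_operator0 : linear_operator M -> graph M (0, 0).
Proof.
move=> [M0 Mlin]; split=> //=; have [_] := Mlin (-1) 0 0 M0 M0.
by rewrite !scaleN1r !addNr.
Qed.

(** Approximate both pairs from the graph inside one graph ball: the approximants nearly agree under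
    [P], so compatibility makes their images nearly agree under [x'] after [P], and functionals
    separate points. *)
Lemma n_strongly_compatible_closure (f u g v : X) :
  n_strongly_compatible P M -> closure (graph M) (f, u) ->
  closure (graph M) (g, v) -> P (f - g) = 0 -> P (u - v) = 0.
Proof.
move=> sM clf clg Pfg; apply: (@dual_separating R k) => x'.
have [C C0 PC] := linear_continuous_bounded cP.
have [y' y'E] := ex_dual_comp x' cP.
rewrite -y'E.
have [D D0 yD] := dual_bounded y'.
apply/normr0_eq0/le_anti; rewrite normr_ge0 andbT.
apply/ler_addgt0Pr => e e0; rewrite add0r.
pose s := (`|f| + `|u|) + (`|g| + `|v|).
have s0 : 0 <= s by rewrite !addr_ge0.
have r0 : 0 < s + 2 by rewrite ltr_wpDl.
have [d d0 dM] := sM (s + 2) x' r0 (e / 2) (divr_gt0 e0 (ltr0Sn _ 1)).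
(* With approximation error [c <= h], graph norms grow by at most [2 * c <= 1 < 2], and [|P (f1 -
   g1)| <= 2 * C * c < 3 * C * c <= d]. *)
have [h h0 [h1 hd]] : exists2 h : K, 0 < h & h <= 1 / 2 /\ h <= d / (3 * C).
  by apply: ex_pos_le; rewrite divr_gt0// mulr_gt0.
(* This bounds the error [2 * D * c] under [y'] by [e / 2]; [D + 1] replaces [D], which may be
   [0]. *)
have [c c0 [ch cD]] : exists2 c : K, 0 < c & c <= h /\ c <= e / (4 * (D + 1)).
  by apply: ex_pos_le => //; rewrite divr_gt0// mulr_gt0// ltr_wpDl.
have near z p : closure (graph M) (z, p) ->
    exists z1, [/\ dom M z1, `|z - z1| <= c & `|p - M z1| <= c].
  move=> /closure_normP-/(_ c c0)[[z1 p1] [/= Mz1 ->]].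
  rewrite prod_normE /= => /ltW; rewrite num_ge_max => /andP[zc pc].
  by exists z1.
have [f1 [Mf1 fc uc]] := near _ _ clf; have [g1 [Mg1 gc vc]] := near _ _ clg.
have ball z p z1 : `|z| + `|p| <= s -> dom M z1 -> `|z - z1| <= c ->
    `|p - M z1| <= c -> graph_ball M (s + 2) z1.
  move=> zps Mz1 zc pc; split=> //.
  have norm1 (x y : X) : `|x - y| <= c -> `|y| <= `|x| + c.
    move=> xy; rewrite -{1}[y](subKr x); apply: le_trans (ler_normB _ _) _.
    by rewrite lerD2l.
  apply: le_lt_trans (lerD (norm1 _ _ zc) (norm1 _ _ pc)) _.
  rewrite addrACA; apply: ler_ltD => //.
  apply: le_lt_trans (lerD (le_trans ch h1) (le_trans ch h1)) _.
  by rewrite -splitr ltr1n.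
have Bf : graph_ball M (s + 2) f1.
  by apply: (ball f u) => //; rewrite lerDl addr_ge0.
have Bg : graph_ball M (s + 2) g1.
  by apply: (ball g v) => //; rewrite lerDr addr_ge0.
have diff (x y x1 y1 : X) : `|x - x1| <= c -> `|y - y1| <= c ->
    `|(x - y) - (x1 - y1)| <= 2 * c.
  move=> xc yc; rewrite opprD addrACA -opprD.
  by rewrite mulr_natl mulr2n; apply: le_trans (ler_normB _ _) _; exact: lerD.
have Pfg1 : `|P (f1 - g1)| < d.
  rewrite -(subKr (f - g) (f1 - g1)) linearB Pfg sub0r normrN.
  apply: le_lt_trans (PC _) _.
  have cC : c * (3 * C) <= d.
    by rewrite -ler_pdivlMr ?mulr_gt0//; exact: le_trans ch hd.
  apply: lt_le_trans cC; apply: le_lt_trans (_ : C * (2 * c) < _).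
    by rewrite ler_pM2l//; exact: diff.
  rewrite [ltRHS](_ : _ = C * (3 * c)); last by ring.
  by rewrite ltr_pM2l// ltr_pM2r// ltr_nat.
rewrite -(subrK (M f1 - M g1) (u - v)) dualD [leRHS]splitr.
apply: le_trans (ler_normD _ _) _; apply: lerD.
  apply: le_trans (yD _) _; apply: le_trans (_ : D * (2 * c) <= _).
    by rewrite ler_wpM2l//; exact: diff.
  have : c * (4 * (D + 1)) <= e.
    by rewrite -ler_pdivlMr ?mulr_gt0// ltr_wpDl.
  rewrite ler_pdivlMr//; apply: le_trans.
  rewrite [leLHS](_ : _ = c * (4 * D)); last by ring.
  by rewrite ler_pM2l// ler_pM2l// lerDl.
by apply/ltW; rewrite y'E; exact: dM.
Qed.

(** The third hypothesis is causality of the closure tested against [0], to which linearity reduces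
    the general case. *)
Lemma causal_n_strongly_compatible :
  reflexive_space X -> linear_operator M ->
  (forall h j, closure (graph M) (h, j) -> P h = 0 -> P j = 0) ->
  n_strongly_compatible P M.
Proof.
move=> rX linM cM r x' r0 e e0.
have [_ Mlin] := linM.
have MB f g : dom M f -> dom M g -> graph M (f - g, M f - M g).
  move=> Mf Mg; have [] := Mlin (-1) g f Mg Mf.
  by rewrite !scaleN1r ![- _ + _]addrC.
have [z' z'E] := ex_dual_comp x' cP.
(* The identity is imposed on the graph only, so [W] contains both the annihilator of the graph
   ([y' = 0]) and all pairs [(y' o P, 0)]. *)
pose W : set (dual X * dual X)%type :=
  [set w : (dual X * dual X)%type | exists y' : dual X,
    forall z, graph M z -> w.1 z.1 + w.2 z.2 = y' (P z.1)].
have [clW|clW] := pselect (closure W (0, z')).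
  (* Differences within the graph ball have norm at most [2 * r], so each component of the error
     costs at most [e / 4]. *)
  have [[a b] [/= y' Wab]] : exists2 w, W w & `|(0, z') - w| < e / (8 * r).
    by apply: closure_normP => //; rewrite divr_gt0// mulr_gt0.
  rewrite prod_normE /= sub0r normrN => abe.
  have {abe} [ae be] : `|a| <= e / (8 * r) /\ `|z' - b| <= e / (8 * r).
    by move: abe => /ltW; rewrite num_ge_max => /andP[].
  have [C C0 yC] := dual_bounded y'.
  have C1 : 0 < C + 1 by rewrite ltr_wpDl.
  (* This leaves less than [e / 2] for the term [y' (P (f - g))]. *)
  exists (e / (2 * (C + 1))); first by rewrite divr_gt0// mulr_gt0.
  move=> f g [Mf fr] [Mg gr] Pfg.
  rewrite -z'E.
  have := Wab _ (MB _ _ Mf Mg) => /= Wfg.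
  have nf : `|f - g| <= 2 * r.
    rewrite mulr_natl mulr2n; apply: le_trans (ler_normB _ _) _; apply: lerD.
      by rewrite (le_trans _ (ltW fr))// lerDl.
    by rewrite (le_trans _ (ltW gr))// lerDl.
  have nM : `|M f - M g| <= 2 * r.
    rewrite mulr_natl mulr2n; apply: le_trans (ler_normB _ _) _; apply: lerD.
      by rewrite (le_trans _ (ltW fr))// lerDr.
    by rewrite (le_trans _ (ltW gr))// lerDr.
  have -> : z' (M f - M g) = (z' - b) (M f - M g) - a (f - g) + y' (P (f - g)).
    rewrite -Wfg [(z' - b) _]/(z' _ - b _).
    by rewrite addrA subrK subrK.
  have e8 (F : numFieldType) (x y : F) : y != 0 ->
      x / (8 * y) * (2 * y) = x / 4 by move=> y0; field.
  have er : e / (8 * r) * (2 * r) = e / 4 by rewrite e8// gt_eqF.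
  apply: le_lt_trans (ler_normD _ _) _.
  rewrite [ltRHS]splitr.
  apply: ler_ltD.
    apply: le_trans (ler_normB _ _) _.
    have e4 (F : numFieldType) (x : F) : x / 2 = x / 4 + x / 4 by field.
    rewrite e4.
    apply: lerD; apply: le_trans (dual_normP _ _) _; rewrite -er.
      by apply: ler_pM => //; exact: dual_norm_ge0.
    by apply: ler_pM => //; exact: dual_norm_ge0.
  apply: le_lt_trans (yC _) _.
  apply: le_lt_trans (_ : (C + 1) * `|P (f - g)| < _).
    by rewrite ler_wpM2r// lerDl.
  by rewrite -ltr_pdivlMl// mulrC -mulrA -invfM.
exfalso.
have [||psi psiW /negP[]] := hahn_banach_subspace _ _ clW.
- by exists 0 => z _ /=; rewrite -[LHS]/(0 + 0) addr0.
- move=> a w1 w2 [y1 Wy1] [y2 Wy2]; exists (a *: y1 + y2) => z Mz.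
  rewrite -[(a *: w1 + w2).1]/(a *: w1.1 + w2.1).
  rewrite -[(a *: w1 + w2).2]/(a *: w1.2 + w2.2).
  by rewrite !dual_evalP -Wy1// -Wy2// mulrDr addrACA.
have [psi1 [psi2 psiE]] := dual_pair psi.
have [x1 x1E] := rX psi1; have [x2 x2E] := rX psi2.
have {psi1 psi2 x1E x2E} psiE w : psi w = w.1 x1 + w.2 x2.
  by rewrite psiE x1E x2E.
(* [psi (0, z')] is [x' (P x2)], which vanishes by causality once [(x1, x2)] is in the closure of
   the graph and [P x1 = 0]. *)
rewrite psiE /= z'E (cM x1 x2) ?dual0 ?addr0//.
(* Otherwise some [chi] vanishes on the graph but not at [(x1, x2)]; its components form a pair in
   [W], and [psi] at that pair is [chi (x1, x2)]. *)
- apply: contrapT => clx.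
  have [||chi chiM /negP[]] := hahn_banach_subspace _ _ clx.
  + exact: graph_linear_operator0.
  + move=> a [f ?] [g ?] [/= Mf ->] [/= Mg ->].
    by have [] := Mlin a f g Mf Mg.
  have [a [b chiE]] := dual_pair chi.
  rewrite chiE /= -[a x1]/((a, b).1 x1) -[X in _ + X]/((a, b).2 x2) -psiE.
  apply/eqP/psiW; exists 0 => z Mz; rewrite -chiE.
  exact: chiM.
(* Since [(y' o P, 0)] is in [W], [psi] kills it, and its value there is [y' (P x1)]. *)
- apply: (@dual_separating R k) => y'; have [t' t'E] := ex_dual_comp y' cP.
  have : psi (t', 0) = 0.
    apply: psiW; exists y' => z _ /=; rewrite -[X in _ + X]/(0 : K) addr0.
    exact: t'E.
  by rewrite psiE /= t'E -[X in _ + X]/(0 : K) addr0.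
Qed.

End compatibility.

Theorem theorem1p0p1 (R : realType) (k : scalar_kind)
    (X : completeNormedModType (scalar_field R k))
    (P : R -> {linear X -> X}) (M : partial_map X) :
  resolution_of_identity P -> reflexive_space X ->
  linear_operator M -> closable M ->
  (causal P (closure_operator M) <-> n_strongly_causal P M).
Proof.
move=> [cP _ _ _ _] rX linM clM; have grE := graph_closure_operator clM.
split=> [cM t|sM t f g domf domg].
  apply: causal_n_strongly_compatible => // h j.
  (* Causality is used with second argument [0], which the closure of [M] maps to [0]. *)
  have cl0 : closure (graph M) (0, 0).
    exact/subset_closure/graph_linear_operator0.
  rewrite -grE in cl0 *; move: cl0 => [dom0 N0] [domh jE] Ph.
  have := cM t h 0 domh dom0.
  rewrite -[closure_operator M h]jE -[closure_operator M 0]N0 /= !subr0.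
  exact.
by apply: (n_strongly_compatible_closure (cP t) (sM t)); rewrite -grE.
Qed.
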